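(* Let $\underline{P}:\mathcal{D}\to\mathbb{R}$ be a lower prevision, with $\mathcal{D}\subseteq\mathcal{D}_{LIN}$, and let $\underline{E}_{2c}$ be its $2$-convex natural extension. If $\underline{E}_{2c}$ is finite on $\mathcal{D}_{LIN}$, then: a) $\underline{E}_{2c}(X|B)\geq\underline{P}(X|B)$ for all $X|B\in\mathcal{D}$. b) $\underline{E}_{2c}$ is $2$-convex on $\mathcal{D}_{LIN}$. c) If $\underline{P}^{*}$ is $2$-convex on $\mathcal{D}_{LIN}$ and $\underline{P}^{*}(X|B)\geq\underline{P}(X|B)$ for all $X|B\in\mathcal{D}$, then $\underline{P}^{*}(X|B)\geq\underline{E}_{2c}(X|B)$ for all $X|B\in\mathcal{D}_{LIN}$. d) $\underline{P}$ is $2$-convex on $\mathcal{D}$ if and only if $\underline{E}_{2c}=\underline{P}$ on $\mathcal{D}$. e) If $\underline{P}$ is $2$-convex on $\mathcal{D}$, then $\underline{E}_{2c}$ is its smallest (pointwise) $2$-convex extension on $\mathcal{D}_{LIN}$.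
   Context: Fix a partition $\mathbb{P}$ of the sure event $\Omega$ into atoms $\omega$. A gamble is a bounded function $X:\mathbb{P}\to\mathbb{R}$. Events are subsets of $\mathbb{P}$, identified with their indicators; $\wedge,\vee,\neg$ denote intersection, union, complement; $\varnothing$ is the impossible event. For a gamble $X$ and an event $B\neq\varnothing$, the conditional gamble $X|B$ is the restriction of $X$ to $B$; thus $\sup(X|B)=\sup_{\omega\in B}X(\omega)$. A lower prevision on a non-empty set $\mathcal{D}$ of conditional gambles is a map $\underline{P}:\mathcal{D}\to\mathbb{R}$. Let $\mathcal{X}$ be a linear space of gambles and $\mathcal{B}\subset\mathcal{X}$ a set of (indicators of) events in $\mathcal{X}$, with $\Omega\in\mathcal{B}$ and $BX\in\mathcal{X}$ for all $B\in\mathcal{B}$, $X\in\mathcal{X}$. Put $\mathcal{B}^{\varnothing}=\mathcal{B}\setminus\{\varnothing\}$ and $\mathcal{D}_{LIN}=\{X|B: X\in\mathcal{X}, B\in\mathcal{B}^{\varnothing}\}$. $\underline{P}$ is $2$-convex on $\mathcal{D}$ iff for all $X_0|B_0,X_1|B_1\in\mathcal{D}$, $\sup\{B_1(X_1-\underline{P}(X_1|B_1))-B_0(X_0-\underline{P}(X_0|B_0))\,|\,B_0\vee B_1\}\geq 0$. For a conditional gamble $Z|B$, let $$L(Z|B)=\{\alpha\in\mathbb{R}:\sup\{A(X-\underline{P}(X|A))-B(Z-\alpha)|A\vee B\}<0\ \text{for some } X|A\in\mathcal{D}\}.$$ The $2$-convex natural extension of $\underline{P}$ on $Z|B$ is $\underline{E}_{2c}(Z|B)=\sup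 L(Z|B)$ (with $\sup\emptyset=-\infty$). *)

(* Defs.v *)
From mathcomp Require Import all_boot all_order all_algebra.
From mathcomp Require Import all_classical all_reals all_analysis.

Set Implicit Arguments.
Unset Strict Implicit.
Unset Printing Implicit Defensive.

Import Order.TTheory GRing.Theory Num.Theory.
Import numFieldNormedType.Exports.

Local Open Scope classical_set_scope.
Local Open Scope ring_scope.

(* The partition is a type T, whose elements are the atoms; events are sets of
   atoms, and the gambles are the X : T -> R such that bounded_fun X. *)

Section TwoConvex.
Context {R : realType} {T : Type}.

(* A conditional gamble X|B is stored as the pair of the restriction of X to B
   (extended outside B by the default value of R) and of B. Values outside B
   are never read, and X|B = Y|B exactly when X and Y agree on B: see cond_eqP. *)
Definition cgamble : Type := ((T -> R) * set T)%type.

Definition cond (X : T -> R) (B : set T) : cgamble := (X \_ B, B).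

Lemma cond_eqP (X Y : T -> R) (A B : set T) :
  cond X A = cond Y B <-> A = B /\ {in B, X =1 Y}.
Proof.
rewrite /cond; split=> [[XY AB]|[-> XY]].
  split=> // w wB; move/(congr1 (@^~ w)): XY.
  by rewrite AB !patchE wB.
congr pair; apply/funext => w; rewrite !patchE.
by case: ifPn => // /XY.
Qed.

(* For Z = X|B, the gamble B(X - a). *)
Definition gain (Z : cgamble) (a : R) : T -> R :=
  \1_(Z.2) \* (Z.1 \- cst a).

(* sup(Y|C), taken in the extended reals; it is a real number as soon as Y is
   bounded and C is nonempty. *)
Definition csup (Y : T -> R) (C : set T) : \bar R :=
  ereal_sup [set (Y w)%:E | w in C].
Arguments csup Y%_R C%_classic.

Definition DLIN (XX : set (T -> R)) (BB : set (set T)) : set cgamble :=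
  [set Z | exists X B, [/\ XX X, BB B, B !=set0 & Z = cond X B]].

(* A lower prevision on D is a total function of which only the values on D
   are used. *)
Definition two_convex (D : set cgamble) (P : cgamble -> R) : Prop :=
  forall Z0 Z1, D Z0 -> D Z1 ->
    (0 <= csup (gain Z1 (P Z1) \- gain Z0 (P Z0)) (Z0.2 `|` Z1.2))%E.

Definition L2c (D : set cgamble) (P : cgamble -> R) (Z : cgamble) : set R :=
  [set a | exists2 W, D W &
    (csup (gain W (P W) \- gain Z a) (W.2 `|` Z.2) < 0)%E].

(* ereal_sup set0 = -oo *)
Definition E2c (D : set cgamble) (P : cgamble -> R) (Z : cgamble) : \bar R :=
  ereal_sup (EFin @` L2c D P Z).

End TwoConvex.
Arguments cgamble : clear implicits.

(* Main.v *)
(* Two gains with negative supremum have a sum with negative supremum: each is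
   uniformly negative on the union of its two events and zero off it, so that
   in [gain W (P W) - gain Z0 a0], written as [gain W (P W) - gain Z1 a1] plus
   [gain Z1 a1 - gain Z0 a0], some summand is uniformly negative at each atom
   and the other is never positive. Hence a violation of 2-convexity of the
   extension at (Z0, Z1) would put a number larger than [E2c D P Z0] in
   [L2c D P Z0]. The other parts follow from the monotonicity of gains. *)
Require Import Defs.
From mathcomp Require Import all_boot all_order all_algebra.
From mathcomp Require Import all_classical all_reals all_analysis.
From mathcomp Require Import ring lra.

Set Implicit Arguments.
Unset Strict Implicit.
Unset Printing Implicit Defensive.

Import Order.TTheory GRing.Theory Num.Theory.
Import numFieldNormedType.Exports.

Local Open Scope classical_set_scope.
Local Open Scope ring_scope.

Section TwoConvexTheory.
Context {R : realType} {T : Type}.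
Implicit Types (Y : T -> R) (C : set T) (Z W : cgamble R T).
Implicit Types (D : set (cgamble R T)) (P Q : cgamble R T -> R).

Lemma csup_lt0P Y C :
  (csup Y C < 0)%E <-> exists2 d, 0 < d & forall w, C w -> Y w <= - d.
Proof.
split=> [Y0|[d d0 Yd]]; last first.
  apply: (@le_lt_trans _ _ (- d)%:E); last by rewrite lte_fin oppr_lt0.
  by apply: ge_ereal_sup => _ [w Cw <-]; rewrite lee_fin Yd.
have ubY w : C w -> ((Y w)%:E <= csup Y C)%E.
  by move=> Cw; apply: ereal_sup_ubound; exists w.
move: Y0 ubY; case: (csup Y C) => [r||] // r0 ubY.
  exists (- r) => [|w Cw]; first by rewrite oppr_gt0 -lte_fin.
  by rewrite opprK -lee_fin ubY.
(* The value [-oo] forces [C] to be empty, so any positive bound will do. *)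
by exists 1 => // w /ubY; rewrite leeNy_eq.
Qed.

Lemma gainB Z a b w : gain Z a w = gain Z b w + \1_(Z.2) w * (b - a).
Proof. by rewrite /gain /=; ring. Qed.

Lemma gain_out Z a w : ~ Z.2 w -> gain Z a w = 0.
Proof. by move=> Zw; rewrite /gain /= indicE memNset// mul0r. Qed.

Lemma le_gain Z a b w : a <= b -> gain Z b w <= gain Z a w.
Proof.
by move=> ab; rewrite (gainB Z a b) lerDl mulr_ge0 ?subr_ge0// indicE.
Qed.

Lemma gain_le_shift Z a e w : 0 <= e -> gain Z (a - e) w <= gain Z a w + e.
Proof.
move=> e0; rewrite (gainB Z (a - e) a) lerD2l opprB addrC subrK indicE.
by case: (w \in _); rewrite ?mul1r ?mul0r.
Qed.

Lemma csup_gain_trans Z0 Z1 Z2 a0 a1 a2 :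
  (csup (gain Z2 a2 \- gain Z1 a1)%R (Z2.2 `|` Z1.2) < 0)%E ->
  (csup (gain Z1 a1 \- gain Z0 a0)%R (Z1.2 `|` Z0.2) < 0)%E ->
  (csup (gain Z2 a2 \- gain Z0 a0)%R (Z2.2 `|` Z0.2) < 0)%E.
Proof.
move=> /csup_lt0P[d d0 Zd] /csup_lt0P[e e0 Ze]; apply/csup_lt0P.
exists (Num.min d e) => [|w Zw]; first by rewrite lt_min d0.
have [md me] : Num.min d e <= d /\ Num.min d e <= e.
  by rewrite !ge_min !lexx orbT.
(* On [Z1.2] both bounds apply and add up. Off it the middle gain vanishes, so the bound on [Z2.2]
   concerns [gain Z2 a2] alone and the one on [Z0.2] concerns [gain Z0 a0] alone. *)
have [Z1w|Z1w] := pselect (Z1.2 w).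
  have := Zd w (or_intror Z1w); have := Ze w (or_introl Z1w) => /=; lra.
have g1 : gain Z1 a1 w = 0 by exact: gain_out.
have [Z2w|Z2w] := pselect (Z2.2 w); have [Z0w|Z0w] := pselect (Z0.2 w).
- have := Zd w (or_introl Z2w); have := Ze w (or_intror Z0w) => /=; lra.
- have g0 : gain Z0 a0 w = 0 by exact: gain_out.
  have := Zd w (or_introl Z2w) => /=; lra.
- have g2 : gain Z2 a2 w = 0 by exact: gain_out.
  have := Ze w (or_intror Z0w) => /=; lra.
- by case: Zw.
Qed.

(** Gains decrease in the price. In particular [L2c D P Z] is closed downwards. *)
Lemma csup_gain_le Z0 Z1 a0 a1 b0 b1 : a0 <= b0 -> b1 <= a1 ->
  (csup (gain Z1 b1 \- gain Z0 b0)%R (Z1.2 `|` Z0.2) < 0)%E ->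
  (csup (gain Z1 a1 \- gain Z0 a0)%R (Z1.2 `|` Z0.2) < 0)%E.
Proof.
move=> ab0 ba1 /csup_lt0P[d d0 Zd]; apply/csup_lt0P; exists d => // w /Zd /=.
by apply: le_trans; rewrite lerB// le_gain.
Qed.

Lemma csup_gain_perturb Z0 Z1 a0 a1 :
  (csup (gain Z1 a1 \- gain Z0 a0)%R (Z1.2 `|` Z0.2) < 0)%E ->
  exists2 e, 0 < e &
    (csup (gain Z1 (a1 - e) \- gain Z0 (a0 + e))%R (Z1.2 `|` Z0.2) < 0)%E.
Proof.
(* Each of the two price shifts costs at most [d / 4], which leaves the margin [d / 2]. *)
move=> /csup_lt0P[d d0 Zd]; have e0 : 0 < d / 4 by rewrite divr_gt0.
exists (d / 4) => //; apply/csup_lt0P.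
exists (d / 2); first by rewrite divr_gt0.
move=> w /Zd /=; have := gain_le_shift Z1 a1 w (ltW e0).
have := gain_le_shift Z0 (a0 + d / 4) w (ltW e0); rewrite addrK; lra.
Qed.

(** A violation takes the form of the condition in [L2c], with [Z1] as witness and [P Z0] as the
    price of [Z0]. *)
Lemma two_convexP D P : two_convex D P <->
  forall Z0 Z1, D Z0 -> D Z1 ->
    ~ (csup (gain Z1 (P Z1) \- gain Z0 (P Z0))%R (Z1.2 `|` Z0.2) < 0)%E.
Proof.
by split=> PP Z0 Z1 DZ0 DZ1; have := PP Z0 Z1 DZ0 DZ1;
  rewrite setUC leNgt => /negP.
Qed.

(** Taking [Z] as its own witness puts every [P Z - e] in [L2c D P Z]: the two gains differ by
    exactly [e] on the event. *)
Lemma le_E2c D P Z : D Z -> ((P Z)%:E <= E2c D P Z)%E.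
Proof.
move=> DZ; apply/lee_subgt0Pr => e e0; apply: ereal_sup_ubound.
exists (P Z - e) => //; exists Z => //; apply/csup_lt0P; exists e => // w.
rewrite setUid => Zw /=.
by rewrite (gainB Z (P Z - e) (P Z)) indicE mem_set// mul1r; lra.
Qed.

(** A price in [L2c D P Z] above [Q Z] would, by monotonicity in both prices, make [Z] and its
    witness violate the 2-convexity of [Q]. The case [D' = D], [Q = P] gives one half of d). *)
Lemma E2c_le (D D' : set (cgamble R T)) P Q : D `<=` D' ->
  two_convex D' Q -> (forall Z, D Z -> P Z <= Q Z) ->
  forall Z, D' Z -> (E2c D P Z <= (Q Z)%:E)%E.
Proof.
move=> DD' /two_convexP QQ PQ Z D'Z; apply: ge_ereal_sup => _ [a [W DW Wa] <-].
rewrite lee_fin leNgt; apply/negP => /ltW Qa.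
by apply: (QQ Z W D'Z (DD' _ DW)); apply: csup_gain_le Wa => //; exact: PQ.
Qed.

Lemma two_convex_E2c (D D' : set (cgamble R T)) P :
  (forall Z, D' Z -> E2c D P Z \is a fin_num) ->
  two_convex D' (fine \o E2c D P).
Proof.
move=> Efin; apply/two_convexP => Z0 Z1 DZ0 DZ1 /csup_gain_perturb[e e0 EZ].
(* The slack [e] serves twice: at [Z1] to get down to a price really in [L2c], at [Z0] to exceed the
   supremum strictly. *)
have [_ [a1 [W DW Wa1] <-] a1E] : exists2 x, (EFin @` L2c D P Z1) x &
    (E2c D P Z1 - e%:E < x)%E.
  by apply: ub_ereal_sup_adherent => //; exact: Efin.
have La0 : L2c D P Z0 (fine (E2c D P Z0) + e).
  exists W => //; apply: csup_gain_trans Wa1 _; apply: csup_gain_le EZ => //=.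
  by rewrite -lee_fin EFinB fineK ?ltW//; exact: Efin.
have : ((fine (E2c D P Z0) + e)%:E <= E2c D P Z0)%E.
  by apply: ereal_sup_ubound; exists (fine (E2c D P Z0) + e).
by rewrite -[leRHS]fineK ?Efin// lee_fin gerDl leNgt e0.
Qed.

End TwoConvexTheory.

Theorem proposition5 (R : realType) (T : Type)
  (XX : set (T -> R)) (BB : set (set T))
  (XX_gamble : XX `<=` bounded_fun)
  (XX_linear : GRing.submod_closed [in XX])
  (BB_XX : forall B : set T, BB B -> XX \1_B)
  (BB_T : BB [set: T])
  (BB_mul : forall (B : set T) (X : T -> R), BB B -> XX X -> XX (\1_B \* X))
  (D : set (cgamble R T)) (D_neq0 : D !=set0)
  (D_DLIN : D `<=` DLIN XX BB)
  (P : cgamble R T -> R)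
  (E_fin : forall Z, DLIN XX BB Z -> E2c D P Z \is a fin_num) :
  [/\ (* a *) forall Z, D Z -> ((P Z)%:E <= E2c D P Z)%E,
      (* b *) two_convex (DLIN XX BB) (fine \o E2c D P),
      (* c *) forall Pstar : cgamble R T -> R,
        two_convex (DLIN XX BB) Pstar ->
        (forall Z, D Z -> P Z <= Pstar Z) ->
        forall Z, DLIN XX BB Z -> (E2c D P Z <= (Pstar Z)%:E)%E,
      (* d *) two_convex D P <-> (forall Z, D Z -> E2c D P Z = (P Z)%:E) &
      (* e *) two_convex D P ->
        [/\ two_convex (DLIN XX BB) (fine \o E2c D P),
            forall Z, D Z -> E2c D P Z = (P Z)%:E &
            forall Q : cgamble R T -> R,
              two_convex (DLIN XX BB) Q ->
              (forall Z, D Z -> Q Z = P Z) ->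
              forall Z, DLIN XX BB Z -> (E2c D P Z <= (Q Z)%:E)%E]].
Proof.
have Econv := two_convex_E2c E_fin.
have EeqP : two_convex D P -> forall Z, D Z -> E2c D P Z = (P Z)%:E.
  move=> PP Z DZ; apply/eqP; rewrite eq_le le_E2c// andbT.
  by apply: E2c_le PP _ _ DZ.
split=> //.
- by move=> Z; exact: le_E2c.
- by move=> Q QQ PQ; exact: E2c_le.
- split=> // EP Z0 Z1 DZ0 DZ1.
  (* 2-convexity passes to the subset [D], where the extension agrees with [P]. *)
  have := Econv Z0 Z1 (D_DLIN _ DZ0) (D_DLIN _ DZ1).
  by rewrite /= !EP.
- move=> PP; split=> //; first exact: EeqP.
  by move=> Q QQ QP; apply: E2c_le => // Z /QP ->.
Qed.
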